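(* Let $N\ge 5$ be odd, and let $G_{N,1}$ be the graph with vertex set $\mathbb Z_N$ in which two distinct vertices $i,j$ are adjacent if and only if $j-i\not\equiv\pm1\pmod N$. Put $\Delta=\sqrt{N(N-4)}$ and $\rho=\frac{N-2+\Delta}{2}$. Then the number of spanning trees of $G_{N,1}$ is \[ \tau(G_{N,1})=\frac{1}{N}\,\frac{(\rho^N+1)^2}{\rho^{N-1}(\rho+1)^2}. \] *)

(* Defs.v *)
From mathcomp Require Import all_boot all_order all_algebra.
Set Implicit Arguments. Unset Strict Implicit. Unset Printing Implicit Defensive.
Import Order.TTheory GRing.Theory Num.Theory.

Definition GN1_adj (N : nat) (i j : 'I_N) : bool :=
  [&& i != j, (j + N - i) %% N != 1 & (j + N - i) %% N != N.-1].

Definition edges (V : finType) (adj : rel V) : {set {set V}} :=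
  [set e : {set V} | [exists i, exists j, adj i j && (e == [set i; j])]
                     && (#|e| == 2)].

Definition edge_rel (V : finType) (T : {set {set V}}) : rel V :=
  fun x y => (x != y) && ([set x; y] \in T).

(* T is a spanning tree of the graph (V, adj): T is a set of edges of the
   graph, the spanning subgraph (V, T) is connected, and it is acyclic
   (every edge of T is a bridge: removing it disconnects its endpoints). *)
Definition is_spanning_tree (V : finType) (adj : rel V) (T : {set {set V}}) : bool :=
  [&& T \subset edges adj,
      [forall x, forall y, connect (edge_rel T) x y] &
      [forall e in T, forall x, forall y,
         (x != y) && ([set x; y] == e) ==> ~~ connect (edge_rel (T :\ e)) x y]].

Definition num_spanning_trees (V : finType) (adj : rel V) : nat :=
  #|[set T : {set {set V}} | is_spanning_tree adj T]|.

(* Main.v *)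
(* Expanding the determinant of the Laplacian, with its row r replaced by e_r,
   along the choice of one out-neighbour f i for each i != r gives a sum of
   determinants of matrices with rows e_i - e_(f i); these are 1 if iterating f
   always leads to r and 0 otherwise, and the maps f of the first kind are the
   spanning trees oriented towards r.  This is the matrix-tree theorem.  As L
   has zero row and column sums, det (L + J) = N^2 tau for the all-ones matrix J.
   Here L + J = (N - 2) I + C + C^T with C the cyclic shift, and since
   rho + rho^-1 = N - 2, rho (L + J) = (rho I + C) (rho I + C)^T, where
   det (rho I + C) = rho^N + 1 for odd N.  Finally (rho + 1)^2 = N rho. *)
Require Import Defs.
From mathcomp Require Import all_boot all_order all_algebra.
From mathcomp Require Import perm fingroup zify ring lra.
Import Order.TTheory GRing.Theory Num.Theory.
Local Open Scope ring_scope.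
Set Implicit Arguments. Unset Strict Implicit. Unset Printing Implicit Defensive.

(** * Row expansion of determinants and functional graphs *)

Lemma sum_delta (R : pzSemiRingType) (I : finType) (j : I) (G : I -> R) :
  \sum_k (k == j)%:R * G k = G j.
Proof.
by rewrite (bigD1 j) //= eqxx mul1r big1 ?addr0 // => k /negbTE->; rewrite mul0r.
Qed.

Lemma fconnectE (T : finType) (f : T -> T) (x y : T) :
  fconnect f x y -> exists k, iter k f x = y.
Proof. by move=> xy; exists (findex f x y); apply: iter_findex. Qed.

Lemma iter_fix (T : Type) (f : T -> T) (x : T) k : f x = x -> iter k f x = x.
Proof. by move=> fx; elim: k => //= k ->. Qed.

Lemma fconnect_fixed (T : finType) (f : T -> T) (x y : T) :
  f x = x -> fconnect f x y -> x = y.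
Proof. by move=> fx /fconnectE[k <-]; rewrite iter_fix. Qed.

(** Multilinearity in the rows: in each Leibniz term the product of sums is distributed over all
    choice functions [f]. *)
Lemma det_row_expansion (R : comNzRingType) n (B : 'I_n -> 'I_n -> R)
    (W : 'I_n -> 'I_n -> 'I_n -> R) :
  \det (\matrix_(i, k) \sum_j B i j * W i j k) =
  \sum_(f : {ffun 'I_n -> 'I_n})
    (\prod_i B i (f i)) * \det (\matrix_(i, k) W i (f i) k).
Proof.
rewrite /determinant.
under eq_bigr => s _.
  rewrite (eq_bigr (fun i => \sum_j B i j * W i j (s i))); last by move=> i _; rewrite mxE.
  rewrite bigA_distr_bigA mulr_sumr /=.
  over.
rewrite exchange_big /=; apply: eq_bigr => f _.
rewrite mulr_sumr; apply: eq_bigr => s _.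
rewrite big_split /= mulrCA; congr (_ * (_ * _)).
by apply: eq_bigr => i _; rewrite mxE.
Qed.

(** If every vertex leads to [r], only the identity survives in the Leibniz formula. Otherwise a
    nonzero kernel vector of the transpose exists. *)
Lemma det_functional_graph (F : fieldType) n (r : 'I_n) (f : 'I_n -> 'I_n) :
  f r = r ->
  \det (\matrix_(i, k) ((i == k)%:R - ((i != r) && (f i == k))%:R) : 'M[F]_n) =
  [forall i, fconnect f i r]%:R.
Proof.
move=> fr; have [/forallP reach|/forallPn[x0 nreach]] := boolP [forall i, fconnect f i r].
  rewrite /determinant (bigD1 1%g) //= [X in _ + X]big1 ?addr0.
    rewrite odd_perm1 expr0 mul1r big1 // => i _.
    rewrite mxE perm1 eqxx; have [_|ir] /= := eqVneq i r; first by rewrite subr0.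
    have [fi|] := eqVneq (f i) i; last by rewrite subr0.
    by case/eqP: ir; apply: fconnect_fixed fi (reach i).
  move=> s s1; apply/eqP; rewrite mulf_eq0; apply/orP; right; apply/prodf_eq0.
  have [/forallP moves|/forallPn[i]] :=
      boolP [forall i, (s i == i) || ((i != r) && (f i == s i))]; last first.
    rewrite negb_or => /andP[si fi]; exists i => //.
    by rewrite mxE [i == s i]eq_sym (negbTE si) (negbTE fi) subrr.
  have [x sx]: exists x, s x != x.
    apply/existsP; apply: contraR s1 => /existsPn fix_s.
    by apply/eqP/permP => x; rewrite perm1; have /negbNE/eqP := fix_s x.
  have [k kr] := fconnectE (reach x).
  (* A point moved by [s] can only go to its image under [f], and injectivity of [s] makes that
     image moved too. The orbit reaches [r], which cannot move. *)
  have orbit_moves m : s (iter m f x) != iter m f x.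
    elim: m => //= m IH; have := moves (iter m f x).
    by rewrite (negbTE IH) /= => /andP[_ /eqP->]; rewrite (inj_eq perm_inj).
  have := orbit_moves k; have := moves r.
  by rewrite kr eqxx /= orbF => ->.
(* The indicator of the vertices that do not reach r is in the kernel. *)
apply/eqP; rewrite -det_tr; apply/det0P.
exists (\row_i (~~ fconnect f i r)%:R).
  by apply/eqP => /rowP/(_ x0); rewrite !mxE nreach => /eqP; rewrite oner_eq0.
apply/rowP => i; rewrite !mxE.
under eq_bigr => j _ do rewrite !mxE mulrBr.
rewrite sumrB (bigD1 i) //= eqxx mulr1 big1 ?addr0; last first.
  by move=> j; rewrite eq_sym => /negbTE->; rewrite mulr0.
have [->|ir] /= := eqVneq i r.
  by rewrite connect0 big1 ?subr0 // => j _; rewrite mulr0.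
rewrite (bigD1 (f i)) //= eqxx mulr1 big1 ?addr0; last first.
  by move=> j; rewrite eq_sym => /negbTE->; rewrite mulr0.
suff -> : fconnect f i r = fconnect f (f i) r by rewrite subrr.
apply/idP/idP => [/fconnectE[[/= ie|k kr]]|].
- by rewrite ie eqxx in ir.
- by rewrite -kr iterSr fconnect_iter.
- by apply: connect_trans; apply: fconnect1.
Qed.

(** * Spanning trees as parent maps towards a root *)

Section RootedTrees.
Variables (V : finType) (adj : rel V) (r : V).
Hypothesis adj_sym : symmetric adj.

(** [f] is the parent map of a tree oriented towards [r]; the root is its own parent so that [f] is
    total. *)
Definition rooted_tree (f : {ffun V -> V}) : bool :=
  [&& f r == r, [forall i, (i != r) ==> adj i (f i)]
    & [forall i, fconnect f i r]].

Definition tree_edges (f : {ffun V -> V}) : {set {set V}} :=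
  [set [set i; f i] | i in predC1 r].

Lemma eq_pair (x y z t : V) : [set x; y] = [set z; t] ->
  (x = z /\ y = t) \/ (x = t /\ y = z).
Proof.
move=> E.
have /set2P xE : x \in [set z; t] by rewrite -E set21.
have /set2P yE : y \in [set z; t] by rewrite -E set22.
have /set2P zE : z \in [set x; y] by rewrite E set21.
have /set2P tE : t \in [set x; y] by rewrite E set22.
by case: xE yE zE tE => -> [] -> [] H1 [] H2; auto.
Qed.

Lemma rooted_treeP (f : {ffun V -> V}) :
  reflect [/\ f r = r, forall i, i != r -> adj i (f i)
             & forall i, fconnect f i r] (rooted_tree f).
Proof.
apply: (iffP and3P) => -[/eqP fr fadj freach]; split => //.
- by move=> i; move/forallP/(_ i)/implyP: fadj.
- exact/forallP.
- by apply/forallP => i; apply/implyP/fadj.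
- exact/forallP.
Qed.

Lemma tree_edgesP (f : {ffun V -> V}) (x y : V) :
  [set x; y] \in tree_edges f ->
  (x != r /\ y = f x) \/ (y != r /\ x = f y).
Proof. by case/imsetP => i ir /eq_pair[][-> ->]; [left|right]. Qed.

Lemma mem_tree_edges (f : {ffun V -> V}) (i : V) :
  i != r -> [set i; f i] \in tree_edges f.
Proof. by move=> ir; apply/imsetP; exists i. Qed.

Lemma edge_rel_sym (T : {set {set V}}) : symmetric (edge_rel T).
Proof. by move=> x y; rewrite /edge_rel eq_sym setUC. Qed.

(** If [i] reaches [r] in [m] steps, going [m] times around a cycle through [i] takes at least [m]
    steps, hence ends at the fixed point [r] and not at [i]. *)
Lemma rooted_tree_neq (f : {ffun V -> V}) i k : rooted_tree f -> i != r ->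
  iter k.+1 f i != i.
Proof.
case/rooted_treeP => fr _ freach ir; apply/eqP => cyc.
have [m mr] := fconnectE (freach i).
have back : iter (m * k.+1) f i = i.
  elim: m {mr} => // m IH; rewrite mulSn iterD IH //.
have : iter (m * k.+1) f i = r.
  by rewrite -(subnK (leq_pmulr m (ltn0Sn k))) iterD mr iter_fix.
by rewrite back => E; rewrite E eqxx in ir.
Qed.

(** Allowing a superset [T] serves both the tree itself and a larger edge set with one edge
    deleted. *)
Lemma tree_edges_connected (f : {ffun V -> V}) (T : {set {set V}}) x y :
  (forall i, fconnect f i r) -> f r = r -> tree_edges f \subset T ->
  (forall i, i != r -> f i != i) ->
  connect (edge_rel T) x y.
Proof.
move=> freach fr sub fne.
have to_root z : connect (edge_rel T) z r.
  apply: connect_sub (freach z) => a b /eqP <- {b}.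
  have [->|ar] := eqVneq a r; first by rewrite fr.
  apply: connect1; rewrite /edge_rel eq_sym fne //=.
  by apply: (subsetP sub); apply: mem_tree_edges.
apply: connect_trans (to_root x) _.
by rewrite (sym_connect_sym (@edge_rel_sym T)).
Qed.

Lemma tree_edges_spanning (f : {ffun V -> V}) :
  rooted_tree f -> is_spanning_tree adj (tree_edges f).
Proof.
move=> ft; have /rooted_treeP[fr fadj freach] := ft.
have fne i : i != r -> f i != i by exact: (rooted_tree_neq 0 ft).
apply/and3P; split.
- apply/subsetP => e /imsetP[i ir ->]; rewrite inE cards2 [i == _]eq_sym fne // eqxx andbT.
  by apply/existsP; exists i; apply/existsP; exists (f i); rewrite fadj /=.
- by apply/forallP => x; apply/forallP => y; apply: (tree_edges_connected _ _ freach fr (subxx _) fne).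
apply/forallP => e; apply/implyP => /imsetP[i ir ->].
apply/forallP => x; apply/forallP => y; apply/implyP => /andP[_ /eqP xyE].
(* Removing {i, f i} cuts off the vertices whose path to the root visits i. *)
pose D := [pred v | fconnect f v i].
have step j : j != i -> (f j \in D) = (j \in D).
  move=> ji; rewrite !inE; apply/idP/idP => [|/fconnectE[[/= E|k <-]]].
  - by apply: connect_trans; apply: fconnect1.
  - by rewrite E eqxx in ji.
  - by rewrite iterSr fconnect_iter.
have closedD : closed (edge_rel (tree_edges f :\ [set i; f i])) D.
  move=> a b /andP[_]; rewrite in_setD1 => /andP[ne /tree_edgesP[] [ar E]].
    rewrite E step //; apply: contraNneq ne => ai.
    by rewrite E ai.
  rewrite E step //; apply: contraNneq ne => bi.
  by rewrite E bi setUC.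
have iD : i \in D by rewrite inE connect0.
have fiD : f i \notin D.
  rewrite inE; apply/negP => /fconnectE[k]; rewrite -iterSr => /eqP.
  by apply/negP; apply: rooted_tree_neq.
apply/negP => /(closed_connect closedD).
by case: (eq_pair xyE) => -[-> ->]; rewrite iD (negbTE fiD).
Qed.

(* If f i != g i, the edge {i, g i} forces f (g i) = i, so f and g still differ
   at g i; iterating g, this disagreement would reach the root. *)
Lemma tree_edges_inj : {in rooted_tree &, injective tree_edges}.
Proof.
move=> f g ft gt E; apply/ffunP => i; apply/eqP/negPn/negP => neq.
have /rooted_treeP[fr _ _] := ft; have /rooted_treeP[gr _ greach] := gt.
have [k kr] := fconnectE (greach i).
suff inv m : (iter m g i != r) && (f (iter m g i) != g (iter m g i)).
  by have := inv k; rewrite kr eqxx.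
elim: m => [|m /andP[]] /=.
  by rewrite neq andbT; apply: contraNneq neq => ->; rewrite fr gr.
move: (iter m g i) => j jr ne.
have := mem_tree_edges g jr; rewrite -E => /tree_edgesP[[_ e]|[gjr fgj]].
  by rewrite e eqxx in ne.
(* Here [f (g j) = j], whereas [g (g j) = j] would be a 2-cycle of [g]. *)
by rewrite gjr -fgj eq_sym; apply: (rooted_tree_neq 1 gt).
Qed.

(** A breadth-first tree: each vertex other than [r] picks a neighbour strictly closer to [r], and
    induction on the distance shows that iteration ends at [r]. *)
Lemma connected_rooted_tree (e : rel V) :
  (forall x, connect e x r) ->
  exists f : {ffun V -> V}, [/\ f r = r, forall i, i != r -> e i (f i)
    & forall i, fconnect f i r].
Proof.
move=> conn.
have dist_ex x : exists n, [exists t : n.-tuple V, path e x t && (r == last x t)].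
  have /connectP[p pth lst] := conn x; exists (size p).
  by apply/existsP; exists (in_tuple p); rewrite /= pth lst eqxx.
pose d x := ex_minn (dist_ex x).
have parent x : x != r -> exists y, e x y && (d y < d x)%N.
  rewrite /d; case: ex_minnP => -[|n] /existsP[t /andP[]].
    by rewrite (tuple0 t) /= => _ rx _; rewrite eq_sym rx.
  case/tupleP: t => y t /= /andP[exy pth] lst _ _; exists y; rewrite exy ltnS /=.
  by case: ex_minnP => m _; apply; apply/existsP; exists t; rewrite pth.
(* By [parent], the default of [odflt] is never taken when [x != r]. *)
pose f := [ffun x => if x == r then r else odflt r [pick y | e x y && (d y < d x)%N]].
have fP x : x != r -> e x (f x) && (d (f x) < d x)%N.
  move=> xr; rewrite ffunE (negbTE xr); case: pickP => [//|none].
  by have [y] := parent x xr; rewrite none.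
exists f; split => [|i /fP/andP[]//|i]; first by rewrite ffunE eqxx.
have [n] := ubnP (d i); elim: n i => // n IH i lt_n.
have [->|ir] := eqVneq i r; first exact: connect0.
have /andP[_ lt_f] := fP i ir.
by apply: connect_trans (fconnect1 f i) (IH _ (leq_trans lt_f lt_n)).
Qed.

(** A parent map chosen inside [T] already connects all vertices, so a further edge of [T] would not
    be a bridge. *)
Lemma tree_edges_surj (T : {set {set V}}) :
  is_spanning_tree adj T -> exists2 f, rooted_tree f & T = tree_edges f.
Proof.
case/and3P => Tsub /forallP Tconn /forallP Tbridge.
have [f [fr fT freach]] := @connected_rooted_tree (edge_rel T)
  (fun x => forallP (Tconn x) r).
have fne i : i != r -> f i != i by move=> /fT/andP[]; rewrite eq_sym.
have fsub : tree_edges f \subset T.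
  by apply/subsetP => e /imsetP[i ir ->]; have /andP[] := fT i ir.
exists f.
  apply/rooted_treeP; split => // i ir; have /andP[_ iT] := fT i ir.
  have := subsetP Tsub _ iT; rewrite inE => /andP[/existsP[a /existsP[b]]].
  by case/andP => ab /eqP/eq_pair[][-> ->]; rewrite // adj_sym.
apply/eqP; rewrite eqEsubset fsub andbT; apply/subsetP => e eT.
apply/negPn/negP => ef.
have := subsetP Tsub e eT; rewrite inE => /andP[/existsP[a /existsP[b]]].
case/andP => _ /eqP eE; rewrite eE cards2 eqSS eqb1 => ab.
have := Tbridge e; rewrite eT /= => /forallP/(_ a)/forallP/(_ b).
rewrite ab eE eqxx /= => /negP; apply.
apply: (@tree_edges_connected f) => //.
by rewrite subsetD1 fsub -eE.
Qed.

Lemma card_rooted_trees : num_spanning_trees adj = #|rooted_tree|.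
Proof.
rewrite -(card_in_imset tree_edges_inj); apply: eq_card => T; rewrite inE.
apply/idP/imsetP => [/tree_edges_surj[f ft ->]|[f ft ->]]; first by exists f.
exact: tree_edges_spanning.
Qed.

End RootedTrees.

(** * The matrix-tree theorem and the determinant of [L + J] *)

Definition row_set (R : Type) n (r : 'I_n) (v : 'I_n -> R) (A : 'M[R]_n) : 'M[R]_n :=
  \matrix_(i, k) if i == r then v k else A i k.

Definition laplacian (R : pzRingType) n (adj : rel 'I_n) : 'M[R]_n :=
  \matrix_(i, k) ((\sum_j (adj i j)%:R) * (i == k)%:R - (adj i k)%:R).

Lemma matrix_tree (F : fieldType) n (r : 'I_n) (adj : rel 'I_n) :
  symmetric adj ->
  \det (row_set r (fun k => (r == k)%:R) (laplacian F adj)) =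
  (num_spanning_trees adj)%:R.
Proof.
move=> adj_sym.
(* For [i != r], row [i] of the Laplacian is the sum of [e_i - e_j] over the neighbours [j]; row [r]
   has the single choice [j = r], with vector [e_r]. The weight of [f] is thus 1 exactly when [f]
   fixes [r] and follows edges elsewhere. *)
pose B i j : F := (if i == r then j == r else adj i j)%:R.
pose W i j k : F := (i == k)%:R - ((i != r) && (j == k))%:R.
transitivity (\det (\matrix_(i, k) \sum_j B i j * W i j k)).
  congr (\det _); apply/matrixP => i k; rewrite !mxE /B /W.
  have [->|ir] /= := eqVneq i r.
    rewrite (bigD1 r) //= eqxx mul1r subr0 big1 ?addr0 // => j /negbTE->.
    by rewrite mul0r.
  under [RHS]eq_bigr => j _ do rewrite mulrBr.
  rewrite sumrB mulr_suml; congr (_ - _).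
  rewrite (bigD1 k) //= eqxx mulr1 big1 ?addr0 // => j /negbTE->.
  by rewrite mulr0.
rewrite det_row_expansion (card_rooted_trees r adj_sym) -sum1_card natr_sum.
rewrite [RHS]big_mkcond /=; apply: eq_bigr => f _.
rewrite unfold_in /rooted_tree.
have [fr|fr] /= := eqVneq (f r) r; last first.
  by rewrite (bigD1 r) //= /B eqxx (negbTE fr) !mul0r.
rewrite det_functional_graph //.
have [/forallP fadj|/forallPn[i]] /= := boolP [forall i, (i != r) ==> adj i (f i)].
  rewrite big1 ?mul1r; first by case: [forall _, _].
  move=> i _; rewrite /B; have [->|ir] := eqVneq i r; first by rewrite fr eqxx.
  by rewrite (implyP (fadj i)).
rewrite negb_imply => /andP[ir nadj].
by rewrite (bigD1 i) //= /B (negbTE ir) (negbTE nadj) !mul0r.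
Qed.

Lemma det_row_set (R : comNzRingType) n (r : 'I_n) v (A : 'M[R]_n) :
  \det (row_set r v A) = \sum_k v k * cofactor A r k.
Proof.
rewrite (expand_det_row _ r); apply: eq_bigr => k _.
rewrite mxE eqxx /cofactor; congr (_ * (_ * \det _)).
by apply/matrixP => i j; rewrite !mxE eq_sym (negbTE (neq_lift _ _)).
Qed.

(* Zero row sums make all cofactors along row r equal. *)
Lemma det_row_set_ones (F : fieldType) n (r : 'I_n) (A : 'M[F]_n) :
  (forall i, \sum_k A i k = 0) ->
  \det (row_set r (fun=> 1) A) = n%:R * \det (row_set r (fun k => (r == k)%:R) A).
Proof.
move=> A0; rewrite !det_row_set.
under [in RHS]eq_bigr => k _ do rewrite eq_sym.
rewrite sum_delta.
transitivity (\sum_(k < n) cofactor A r r); last by rewrite sumr_const card_ord mulr_natl.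
apply: eq_bigr => j _.
rewrite mul1r; apply/eqP; rewrite -subr_eq0.
(* With row [r] equal to [e_j - e_r] all row sums vanish, so the all-ones vector is in the kernel;
   this determinant is the difference of the two cofactors. *)
have : \det (row_set r (fun k => (k == j)%:R * 1 - (k == r)%:R * 1) A) == 0.
  rewrite -det_tr; apply/det0P; exists (const_mx 1).
    by apply/eqP => /rowP/(_ r); rewrite !mxE => /eqP; rewrite oner_eq0.
  apply/rowP => i; rewrite !mxE.
  under eq_bigr => k _ do rewrite !mxE mul1r.
  by case: eqP => _; [rewrite sumrB !sum_delta subrr | apply: A0].
rewrite det_row_set; under eq_bigr => k _ do rewrite !mulr1 mulrBl.
by rewrite sumrB !sum_delta.
Qed.

(** Adding all rows to row [r] makes it constant [n], giving one factor [n]. Subtracting the row of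
    ones from the others restores [L] there, and [det_row_set_ones] gives the second factor. *)
Lemma det_add_ones (F : fieldType) n (r : 'I_n) (L : 'M[F]_n) :
  (forall i, \sum_k L i k = 0) -> (forall k, \sum_i L i k = 0) ->
  \det (L + const_mx 1) =
  n%:R ^+ 2 * \det (row_set r (fun k => (r == k)%:R) L).
Proof.
move=> rows0 cols0; set A := L + const_mx 1.
have colsA k : \sum_i A i k = n%:R.
  under eq_bigr => i _ do rewrite !mxE.
  by rewrite big_split /= cols0 add0r sumr_const card_ord.
have -> : \det A = n%:R * \det (row_set r (fun=> 1) A).
  (* Column [r] of [A *m \adj A] sums to [\det A]; exchanging the sums brings out the column sums of
     [A]. *)
  transitivity (\sum_i (A *m \adj A) i r).
    rewrite mul_mx_adj -[LHS](sum_delta r (fun=> \det A)).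
    by apply: eq_bigr => i _; rewrite mxE mulr_natl.
  rewrite det_row_set mulr_sumr.
  under eq_bigr => i _ do rewrite mxE.
  rewrite exchange_big; apply: eq_bigr => k _ /=.
  by rewrite -mulr_suml colsA mxE mul1r.
rewrite expr2 -mulrA -det_row_set_ones //; congr (_ * _).
(* [E] subtracts row [r] from every other row; it is the functional-graph matrix of the constant map
   [r]. *)
pose E : 'M[F]_n := \matrix_(i, k) ((i == k)%:R - ((i != r) && (r == k))%:R).
have detE : \det E = 1.
  rewrite (@det_functional_graph F n r (fun=> r)) //.
  suff -> : [forall i, fconnect (fun=> r) i r] by [].
  by apply/forallP => i; apply: fconnect1.
rewrite -[LHS]mul1r -[X in X * _]detE -det_mulmx; congr (\det _).
apply/matrixP => i k; rewrite !mxE.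
under eq_bigr => j _ do rewrite !mxE mulrBl [i == j]eq_sym [r == j]eq_sym.
rewrite sumrB sum_delta; have [_|ir] /= := eqVneq i r.
  by rewrite big1 ?subr0 // => j _; rewrite mul0r.
by rewrite sum_delta eqxx addrK.
Qed.

(* A permutation moving every index by at most one step of the cycle s is
   either 1 or s, so only two terms of the Leibniz formula survive. *)
Lemma det_add_cycle (R : idomainType) n (s : {perm 'I_n}) (x : R) :
  ~~ odd_perm s -> (forall i, s i != i) -> (forall i j, fconnect s i j) ->
  \det (\matrix_(i, k) ((k == i)%:R * x + (k == s i)%:R) : 'M[R]_n) =
  x ^+ n + (0 < n)%:R.
Proof.
case: n s => [|n] s s_even s_move s_trans; first by rewrite det_mx00 expr0 addr0.
have s1 : s != 1%g by apply: contraNneq (s_move ord0) => ->; rewrite perm1.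
rewrite /determinant (bigD1 1%g) //= (bigD1 s) //= [X in _ + (_ + X)]big1 ?addr0.
  rewrite odd_perm1 (negbTE s_even) expr0 !mul1r; congr (_ + _); last first.
    by rewrite big1 // => i _; rewrite mxE (negbTE (s_move i)) eqxx mul0r add0r.
  rewrite -[in RHS](card_ord n.+1) -prodr_const; apply: eq_bigr => i _.
  by rewrite mxE perm1 eqxx eq_sym (negbTE (s_move i)) mul1r addr0.
move=> t /andP[t1 ts]; apply/eqP; rewrite mulf_eq0; apply/orP; right; apply/prodf_eq0.
have [/forallP moves|/forallPn[i]] := boolP [forall i, (t i == i) || (t i == s i)]; last first.
  rewrite negb_or => /andP[ti tsi]; exists i => //.
  by rewrite mxE (negbTE ti) (negbTE tsi) mul0r addr0.
have [i ti]: exists i, t i != i.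
  apply/existsP; apply: contraR t1 => /existsPn fix_t.
  by apply/eqP/permP => i; rewrite perm1; have /negbNE/eqP := fix_t i.
have orbit_moves m : t (iter m s i) != iter m s i.
  elim: m => //= m IH; have := moves (iter m s i).
  by rewrite (negbTE IH) /= => /eqP <-; rewrite (inj_eq perm_inj).
case/eqP: ts; apply/permP => j; have [m <-] := fconnectE (s_trans i j).
by have := moves (iter m s i); rewrite (negbTE (orbit_moves m)) => /eqP.
Qed.

(** * The cyclic shift and the Laplacian of the graph *)

Definition cyc n : {perm 'I_n} := perm (@ordS_inj n).

Lemma iter_cyc n k (i : 'I_n) : iter k (cyc n) i = ((i + k) %% n)%N :> nat.
Proof.
elim: k => [|k IH] /=; first by rewrite addn0 modn_small.
by rewrite permE /= IH addnS -addn1 modnDml addn1.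
Qed.

Lemma cyc_transitive n (i j : 'I_n) : fconnect (cyc n) i j.
Proof.
(* The [n - i] steps lead from [i] to 0 modulo [n], and [j] more lead to [j]. *)
rewrite -(_ : iter (j + (n - i)) (cyc n) i = j) ?fconnect_iter //.
apply: val_inj; rewrite /= iter_cyc addnCA subnKC ?modnDr ?modn_small //.
exact/ltnW.
Qed.

(** The [n]-th power of the shift is 1, and an odd power has the same parity as the shift itself. *)
Lemma cyc_even n : odd n -> ~~ odd_perm (cyc n).
Proof.
have cycn : (cyc n ^+ n = 1)%g.
  apply/permP => i; apply: val_inj; rewrite permX perm1 /= iter_cyc.
  by rewrite modnDr modn_small.
have oddX k : odd_perm (cyc n ^+ k)%g = odd k && odd_perm (cyc n).
  elim: k => [|k IH]; first by rewrite expg0 odd_perm1.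
  by rewrite expgS odd_permM IH /=; case: (odd k) (odd_perm _) => [] [].
by move=> n_odd; have := oddX n; rewrite cycn odd_perm1 n_odd /= => <-.
Qed.

(** Removing the modulus leaves case distinctions that [lia] can settle. *)
Lemma val_cyc n (i : 'I_n) : cyc n i = (if i.+1 == n then 0 else i.+1)%N :> nat.
Proof.
rewrite permE /=; have [->|ne] := eqVneq; first exact: modnn.
by rewrite modn_small // ltn_neqAle ne ltn_ord.
Qed.

Lemma GN1_adjE n (i k : 'I_n) :
  (2 < n)%N -> GN1_adj i k = [&& i != k, cyc n i != k & cyc n k != i].
Proof.
move=> n2; rewrite /GN1_adj -!val_eqE /= !val_cyc.
have -> : ((k + n - i) %% n = if i <= k then k - i else k + n - i)%N.
  have := ltn_ord i; have := ltn_ord k => kn lt_in; case: (leqP i k) => ik.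
    by rewrite addnC -addnBA // modnDl modn_small //; lia.
  by rewrite modn_small //; lia.
have := ltn_ord i; have := ltn_ord k.
do 3 case: ifP; lia.
Qed.

(** For [n > 2] the three excluded cases are mutually exclusive, so the adjacency matrix is
    [J - I - C - C^T]. *)
Lemma GN1_adj_nat (R : comNzRingType) n (i k : 'I_n) : (2 < n)%N ->
  (GN1_adj i k)%:R =
  1 - ((k == i)%:R + (k == cyc n i)%:R + (i == cyc n k)%:R) :> R.
Proof.
move=> n2; rewrite GN1_adjE // ![cyc n _ == _]eq_sym [i == k]eq_sym.
have : ((k == i) + (k == cyc n i) + (i == cyc n k) <= 1)%N.
  rewrite -!val_eqE /= !val_cyc.
  have := ltn_ord i; have := ltn_ord k.
  do 2 case: ifP; lia.
by case: (k == i); case: (k == cyc n i); case: (i == cyc n k) => //= _; ring.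
Qed.

Lemma det_GN1_laplacian (F : fieldType) n (x : F) : (2 < n)%N -> odd n ->
  x ^+ 2 + 1 = x * (n%:R - 2) ->
  x ^+ n * \det (laplacian F (@GN1_adj n) + const_mx 1) = (x ^+ n + 1) ^+ 2.
Proof.
move=> n2 n_odd xE; set P : 'M[F]_n := \matrix_(i, k) ((k == i)%:R * x + (k == cyc n i)%:R).
have detP : \det P = x ^+ n + 1.
  rewrite det_add_cycle; first by rewrite (ltn_trans _ n2).
  - exact: cyc_even.
  - by move=> i; rewrite -val_eqE /= val_cyc; have := ltn_ord i; case: ifP; lia.
  - exact: cyc_transitive.
rewrite -detZ expr2 -{1}detP -detP -[X in _ * X]det_tr -det_mulmx.
congr (\det _); apply/matrixP => i k; rewrite !mxE.
(* Each vertex misses itself and its two cyclic neighbours. *)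
have deg : \sum_j (GN1_adj i j)%:R = n%:R - 3 :> F.
  under eq_bigr => j _ do rewrite GN1_adj_nat //.
  rewrite sumrB sumr_const card_ord !big_split /=.
  have count (j : 'I_n) : \sum_k (k == j)%:R = 1 :> F.
    rewrite -[RHS](sum_delta j (fun=> 1)).
    by apply: eq_bigr => ? _; rewrite mulr1.
  rewrite !count (reindex_inj (perm_inj (s := (cyc n)^-1%g))) /=.
  under eq_bigr => j _ do rewrite permKV eq_sym.
  by rewrite count; ring.
rewrite deg GN1_adj_nat //.
under eq_bigr => j _ do rewrite !mxE mulrDl -mulrA.
rewrite big_split /= !sum_delta (inj_eq perm_inj) ![k == _]eq_sym.
(* A single monomial on the left lets [ring] use the relation as a substitution. *)
have {}xE : n%:R * x = x ^+ 2 + 1 + 2 * x by rewrite xE; ring.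
by move: n%:R xE => m xE; ring: xE.
Qed.

Lemma GN1_adj_sym n : (2 < n)%N -> symmetric (@GN1_adj n).
Proof.
move=> n2 i k; rewrite !GN1_adjE // eq_sym; congr (_ && _); exact: andbC.
Qed.

Lemma laplacian_row_sum (R : comPzRingType) n (adj : rel 'I_n) i :
  \sum_k laplacian R adj i k = 0.
Proof.
under eq_bigr => k _ do rewrite mxE mulrC eq_sym.
by rewrite sumrB sum_delta subrr.
Qed.

Lemma laplacian_sym (R : pzRingType) n (adj : rel 'I_n) i k :
  symmetric adj -> laplacian R adj i k = laplacian R adj k i.
Proof. by move=> sym; rewrite !mxE sym eq_sym; have [->|] := eqVneq k i; rewrite ?mulr0. Qed.
Unset Implicit Arguments.

Theorem theorem4p2 (R : rcfType) (N : nat) (hN : (5 <= N)%N) (hodd : odd N) :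
  let Delta : R := Num.sqrt (N%:R * (N%:R - 4)) in
  let rho : R := (N%:R - 2 + Delta) / 2 in
  (num_spanning_trees (@GN1_adj N))%:R =
    N%:R^-1 * ((rho ^+ N + 1) ^+ 2 / (rho ^+ N.-1 * (rho + 1) ^+ 2)).
Proof.
move=> Delta rho.
have N2 : (2 < N)%N by apply: leq_trans hN.
have N5 : 5 <= N%:R :> R by rewrite (ler_nat R 5 N).
have DeltaE : Delta ^+ 2 = N%:R * (N%:R - 4).
  by rewrite sqr_sqrtr // mulr_ge0 //; lra.
have rhoE : rho ^+ 2 + 1 = rho * (N%:R - 2).
  by rewrite /rho; field: DeltaE.
have Delta_ge0 : 0 <= Delta by apply: sqrtr_ge0.
have rho_gt0 : 0 < rho by rewrite divr_gt0 //; lra.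
have N_gt0 : (0 < N)%N by apply: ltn_trans N2.
have := det_GN1_laplacian N2 hodd rhoE.
have sym := GN1_adj_sym N2.
rewrite (det_add_ones (Ordinal N_gt0)) ?matrix_tree //; first last.
- by move=> k; under eq_bigr => i _ do rewrite laplacian_sym //; apply: laplacian_row_sum.
- by move=> i; apply: laplacian_row_sum.
(* The numerator becomes [rho ^+ N] times [N ^ 2] times the tree count, and the denominator
   [rho ^+ N * N]; only cancellation remains. *)
move=> <-; have -> : (rho + 1) ^+ 2 = rho * N%:R.
  by rewrite sqrrD1; move: rhoE; lra.
have -> : rho ^+ N = rho * rho ^+ N.-1 by rewrite -exprS prednK.
have : rho != 0 by rewrite gt_eqF.
have : N%:R != 0 :> R by rewrite gt_eqF //; lra.
have : rho ^+ N.-1 != 0 by rewrite expf_neq0 // gt_eqF.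
by move: (rho ^+ _) => y y0 n0 r0; field; rewrite y0 n0 r0.
Qed.
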